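(* Let $G=(L,R,E)$ be a finite bipartite graph whose vertex sets $L$ and $R$ are each equipped with a linear ordering (preference relation) $\succ$. Then $G$ has exactly one greedy matching, i.e., among all maximal matchings $M$ of $G$, exactly one has the property that $v_M$ is reachable from $v_\emptyset$ in the digraph $D_G$ defined below.
   Context: For $x\in L,y\in R$ write $x\sim y$ if $\{x,y\}\in E$; $a\succ b$ means $a$ is preferred over $b$. For a matching $M\subseteq E$, let $L_M\subseteq L$ be the set of vertices of $L$ not matched by $M$ that are adjacent to at least one vertex of $R$ not matched by $M$; define $R_M\subseteq R$ analogously. The digraph $D_G=(V,A)$ has vertex set $V=\{v_M : M\subseteq E \text{ a matching in } G\}$ (including the empty matching), and contains the arc $(v_M,v_{M'})$ iff $L_M$ and $R_M$ are nonempty and $M'=M\cup\{\{x^*,y^*\}\}$ where at least one of the following holds: (L-condition) $x^*$ is the most preferred vertex of $L_M$ and $y^*$ is the most preferred vertex of $\{y\in R_M: y\sim x^*\}$; (R-condition) $y^*$ is the most preferred vertex of $R_M$ and $x^*$ is the most preferred vertex of $\{x\in L_M : x\sim y^*\}$. A vertex $b$ is reachable from $a$ if $D_G$ contains a directed path from $a$ to $b$ (possibly of length $0$). A matching $M$ is a greedy matching if $v_M$ is a sink of $D_G$ (equivalently, $M$ is a maximal matching) and $v_M$ is reachable from $v_\emptyset$. *)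

(* Defs.v *)
From mathcomp Require Import all_boot all_order.

Set Implicit Arguments.
Unset Strict Implicit.
Unset Printing Implicit Defensive.

(* A finite bipartite graph (L, R, E) is given by two finite types L and R    *)
(* and a set E : {set L * R}; the pair (x, y) stands for the edge {x, y}.     *)
(* That a is preferred over b is expressed by b < a, in L as in R.            *)

Section Defs.

Context {dL dR : Order.disp_t} {L : finOrderType dL} {R : finOrderType dR}.

Implicit Types (E M : {set L * R}) (x : L) (y : R).

Definition adj E x y : bool := (x, y) \in E.

Definition matching E M : bool :=
  (M \subset E) &&
  [forall e in M, forall f in M, (e.1 == f.1) || (e.2 == f.2) ==> (e == f)].

Definition matchedL M x : bool := [exists y, (x, y) \in M].

Definition matchedR M y : bool := [exists x, (x, y) \in M].

Definition Lfree E M : {set L} :=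
  [set x | ~~ matchedL M x & [exists y, ~~ matchedR M y && adj E x y]].

Definition Rfree E M : {set R} :=
  [set y | ~~ matchedR M y & [exists x, ~~ matchedL M x && adj E x y]].

Definition most_preferred {d : Order.disp_t} {T : finOrderType d}
    (S : {set T}) (a : T) : bool :=
  (a \in S) && [forall b in S, (b != a) ==> (b < a)%O].

Definition Lcond E M x y : bool :=
  most_preferred (Lfree E M) x &&
  most_preferred [set y' in Rfree E M | adj E x y'] y.

Definition Rcond E M x y : bool :=
  most_preferred (Rfree E M) y &&
  most_preferred [set x' in Lfree E M | adj E x' y] x.

Definition DGvertex E := {M : {set L * R} | matching E M}.

Definition DGarc E : rel (DGvertex E) := fun v w =>
  [&& Lfree E (val v) != set0, Rfree E (val v) != set0 &
    [exists x, exists y,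
      (val w == (x, y) |: val v) &&
      (Lcond E (val v) x y || Rcond E (val v) x y)]].

Lemma matching0 E : matching E set0.
Proof.
by rewrite /matching sub0set; apply/forall_inP => e; rewrite inE.
Qed.

Definition DGempty E : DGvertex E := Sub set0 (matching0 E).

Definition reachable E : rel (DGvertex E) := connect (@DGarc E).

Definition sink E (v : DGvertex E) : bool := [forall w, ~~ DGarc v w].

Definition maximal_matching E M : bool := maxset (matching E) M.

Definition greedy_matching E (v : DGvertex E) : bool :=
  sink v && reachable (DGempty E) v.

End Defs.

(* Main.v *)
(** Every arc enlarges the matching, and [D_G] has the diamond property: the
    L-arc and the R-arc leaving [M] add edges [(x, y)] and [(x', y')] that are
    either equal or vertex-disjoint, since as soon as they share an endpoint
    the other endpoint is forced by the preferences. In the disjoint case each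
    edge stays eligible after the other one is added, so the two arcs commute.
    As in Newman's lemma, every vertex then reaches exactly one sink. *)

Require Import Defs.
From mathcomp Require Import all_boot all_order.

Set Implicit Arguments.
Unset Strict Implicit.
Unset Printing Implicit Defensive.

Import Order.TTheory.

(** * Terminating relations with the diamond property *)

Section Confluence.

Variables (T : finType) (r : rel T) (m : T -> nat) (n : nat).
Hypothesis m_bound : forall v, m v <= n.
Hypothesis r_incr : forall v w, r v w -> m v < m w.

(** The gap [n - m v] strictly decreases along [r], so this is well-founded induction in which the
    hypothesis is available at all successors. *)
Lemma incr_ind (P : T -> Prop) :
  (forall v, (forall w, r v w -> P w) -> P v) -> forall v, P v.
Proof.
move=> IH v; have [k] := ubnP (n - m v); elim: k v => // k IHk v lt_k.
apply: IH => w /r_incr lt_vw; apply: IHk.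
by apply: leq_trans (ltn_sub2l (leq_trans lt_vw (m_bound w)) lt_vw) _.
Qed.

Definition terminal v := [forall w, ~~ r v w].

Lemma terminal_connect v w : terminal v -> connect r v w -> w = v.
Proof.
move=> /forallP tv /connectP[[|u p] /=]; first by [].
by rewrite (negPf (tv u)).
Qed.

Lemma connect_step v w :
  connect r v w -> v = w \/ exists2 u, r v u & connect r u w.
Proof.
move=> /connectP[[|u p] /=]; first by left.
by move=> /andP[rvu pu] ->; right; exists u => //; apply/connectP; exists p.
Qed.

Lemma connect_terminal v : exists2 s, terminal s & connect r v s.
Proof.
elim/incr_ind: v => v IH; have [tv|] := boolP (terminal v).
  by exists v.
rewrite negb_forall => /existsP[w]; rewrite negbK => rvw.
have [s ts ws] := IH w rvw; exists s => //.
exact: connect_trans (connect1 rvw) ws.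
Qed.

Hypothesis diamond : forall v w1 w2,
  r v w1 -> r v w2 -> w1 = w2 \/ exists2 u, r w1 u & r w2 u.

(** If either path is empty, [v] is itself terminal and the other path is empty too. Otherwise
    compare the first steps [w1] and [w2] of the two paths. *)
Lemma terminal_uniq v s t :
  terminal s -> terminal t -> connect r v s -> connect r v t -> s = t.
Proof.
elim/incr_ind: v s t => v IH s t ts tt vs vt.
case: (connect_step vs) => [def_s|[w1 rvw1 w1s]].
  by rewrite def_s in vt; rewrite (terminal_connect ts vt).
case: (connect_step vt) => [def_t|[w2 rvw2 w2t]].
  by rewrite def_t in vs; rewrite (terminal_connect tt vs).
case: (diamond rvw1 rvw2) => [def_w|[u r1 r2]].
  by rewrite -def_w in w2t; apply: IH rvw1 _ _ _ _ w1s w2t.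
(* A terminal [z] below the common successor [u] is reached from both [w1] and [w2]; induction at
   [w1] gives [s = z], and at [w2] gives [t = z]. *)
have [z tz uz] := connect_terminal u.
rewrite (IH w1 rvw1 s z ts tz w1s (connect_trans (connect1 r1) uz)).
by rewrite (IH w2 rvw2 t z tt tz w2t (connect_trans (connect1 r2) uz)).
Qed.

End Confluence.

(** * Maxima of sets under a preference order *)

Section MostPreferred.

Context {d : Order.disp_t} {T : finOrderType d}.
Implicit Types (S : {set T}) (a b : T).

Lemma most_preferredP S a :
  reflect (a \in S /\ forall b, b \in S -> (b <= a)%O) (most_preferred S a).
Proof.
apply: (iffP andP) => -[aS amax]; split=> //.
  move=> b bS; have [->|ba] := eqVneq b a; first exact: lexx.
  by apply: ltW; apply: (implyP (forall_inP amax b bS)).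
apply/forall_inP => b bS; apply/implyP => ba.
by rewrite lt_neqAle ba amax.
Qed.

Lemma most_preferred_in S a : most_preferred S a -> a \in S.
Proof. by case/andP. Qed.

Lemma most_preferred_ex S a : a \in S -> exists b, most_preferred S b.
Proof.
move=> aS; case: (@arg_maxP _ _ _ a (mem S) id aS) => b bS bmax.
by exists b; apply/most_preferredP.
Qed.

Lemma most_preferred_uniq S a b :
  most_preferred S a -> most_preferred S b -> a = b.
Proof.
move=> /most_preferredP[aS amax] /most_preferredP[bS bmax].
by apply: le_anti; rewrite amax // bmax.
Qed.

(** Free sets shrink as the matching grows; this keeps a top vertex on top for as long as it stays
    free. *)
Lemma most_preferred_sub S S' a :
  S' \subset S -> a \in S' -> most_preferred S a -> most_preferred S' a.
Proof.
move=> sS aS' /most_preferredP[_ amax]; apply/most_preferredP; split=> // b bS'.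
exact/amax/(subsetP sS).
Qed.

End MostPreferred.

(** * Edges that can extend a matching *)

Section Greedy.

Context {dL dR : Order.disp_t} {L : finOrderType dL} {R : finOrderType dR}.
Variable E : {set L * R}.
Implicit Types (M : {set L * R}) (x : L) (y : R) (v w : DGvertex E).

(** [Lfree] and [Rfree] are the two projections of this relation, so it treats both sides
    symmetrically. *)
Definition free_edge M x y :=
  [&& ~~ matchedL M x, ~~ matchedR M y & (x, y) \in E].

Lemma matchedL_U1 M x y x' :
  matchedL ((x, y) |: M) x' = (x' == x) || matchedL M x'.
Proof.
apply/existsP/orP => [[y']|[/eqP->|/existsP[y' My']]].
- rewrite !inE => /orP[/eqP[-> _]|My']; first by left.
  by right; apply/existsP; exists y'.
- by exists y; rewrite setU11.
- by exists y'; rewrite setU1r.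
Qed.

Lemma matchedR_U1 M x y y' :
  matchedR ((x, y) |: M) y' = (y' == y) || matchedR M y'.
Proof.
apply/existsP/orP => [[x']|[/eqP->|/existsP[x' Mx']]].
- rewrite !inE => /orP[/eqP[_ ->]|Mx']; first by left.
  by right; apply/existsP; exists x'.
- by exists x; rewrite setU11.
- by exists x'; rewrite setU1r.
Qed.

Lemma free_edge_U1 M x y x' y' :
  free_edge ((x', y') |: M) x y = [&& x != x', y != y' & free_edge M x y].
Proof.
rewrite /free_edge matchedL_U1 matchedR_U1 !negb_or.
by rewrite -!andbA; do !bool_congr.
Qed.

Lemma free_edge_notin M x y : free_edge M x y -> (x, y) \notin M.
Proof. by case/andP=> + _; apply: contra => Mxy; apply/existsP; exists y. Qed.

Lemma LfreeP M x : reflect (exists y, free_edge M x y) (x \in Lfree E M).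
Proof.
rewrite inE; apply: (iffP andP) => [[nx /existsP[y /andP[ny xy]]]|].
  by exists y; apply/and3P.
by case=> y /and3P[nx ny xy]; split=> //; apply/existsP; exists y; rewrite ny.
Qed.

Lemma RfreeP M y : reflect (exists x, free_edge M x y) (y \in Rfree E M).
Proof.
rewrite inE; apply: (iffP andP) => [[ny /existsP[x /andP[nx xy]]]|].
  by exists x; apply/and3P.
by case=> x /and3P[nx ny xy]; split=> //; apply/existsP; exists x; rewrite nx.
Qed.

(** For a free [x], an unmatched neighbour [y] is automatically in [Rfree], with [x] as witness. The
    second half of [Lcond] thus ranges over the free edges at [x]. *)
Lemma Lnbr_free M x y : x \in Lfree E M ->
  (y \in [set y' in Rfree E M | adj E x y']) = free_edge M x y.
Proof.
move=> /LfreeP[_ /and3P[nx _ _]]; apply/setIdP/idP => [[]|fxy].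
  by move=> /RfreeP[_ /and3P[_ ny _]] xy; apply/and3P.
by split; [apply/RfreeP; exists x | case/and3P: fxy].
Qed.

Lemma Rnbr_free M x y : y \in Rfree E M ->
  (x \in [set x' in Lfree E M | adj E x' y]) = free_edge M x y.
Proof.
move=> /RfreeP[_ /and3P[_ ny _]]; apply/setIdP/idP => [[]|fxy].
  by move=> /LfreeP[_ /and3P[nx _ _]] xy; apply/and3P.
by split; [apply/LfreeP; exists y | case/and3P: fxy].
Qed.

Lemma Lcond_free M x y : Lcond E M x y -> free_edge M x y.
Proof.
by case/andP=> /most_preferred_in xL /most_preferred_in; rewrite Lnbr_free.
Qed.

Lemma Rcond_free M x y : Rcond E M x y -> free_edge M x y.
Proof.
by case/andP=> /most_preferred_in yR /most_preferred_in; rewrite Rnbr_free.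
Qed.

(** * Uniqueness, compatibility and persistence of the L- and R-conditions *)

Lemma Lcond_uniq M x y x' y' :
  Lcond E M x y -> Lcond E M x' y' -> (x, y) = (x', y').
Proof.
move=> /andP[xtop ytop] /andP[x'top]; rewrite (most_preferred_uniq x'top xtop).
by move=> /(most_preferred_uniq ytop)->.
Qed.

Lemma Rcond_uniq M x y x' y' :
  Rcond E M x y -> Rcond E M x' y' -> (x, y) = (x', y').
Proof.
move=> /andP[ytop xtop] /andP[y'top]; rewrite (most_preferred_uniq y'top ytop).
by move=> /(most_preferred_uniq xtop)->.
Qed.

(** If [x = x'], then [y'] is a free neighbour of [x] and tops all of [Rfree], hence tops the free
    neighbours of [x], where [y] is the maximum; so [y = y']. The case [y = y'] is symmetric. *)
Lemma Lcond_Rcond M x y x' y' : Lcond E M x y -> Rcond E M x' y' ->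
  (x, y) = (x', y') \/ x != x' /\ y != y'.
Proof.
move=> LC RC; have fxy := Lcond_free LC; have fxy' := Rcond_free RC.
case/andP: LC => xtop ytop; case/andP: RC => y'top x'top.
have xL := most_preferred_in xtop; have yR := most_preferred_in y'top.
have [xx'|nx] := eqVneq x x'.
  left; rewrite -xx' in fxy' *; congr (_, _).
  apply: most_preferred_uniq ytop (most_preferred_sub _ _ y'top).
    by apply/subsetP => z /setIdP[].
  by rewrite Lnbr_free.
have [yy'|ny] := eqVneq y y'; last by right.
left; rewrite -yy' in fxy x'top yR *; congr (_, _).
apply: (most_preferred_uniq (most_preferred_sub _ _ xtop) x'top).
  by apply/subsetP => z /setIdP[].
by rewrite Rnbr_free.
Qed.

Lemma Lfree_U1 M x y : Lfree E ((x, y) |: M) \subset Lfree E M.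
Proof.
apply/subsetP => x' /LfreeP[y']; rewrite free_edge_U1 => /and3P[_ _ fxy].
by apply/LfreeP; exists y'.
Qed.

Lemma Rfree_U1 M x y : Rfree E ((x, y) |: M) \subset Rfree E M.
Proof.
apply/subsetP => y' /RfreeP[x']; rewrite free_edge_U1 => /and3P[_ _ fxy].
by apply/RfreeP; exists x'.
Qed.

(** The edge [(x, y)] stays free because the new edge misses both its endpoints, and both sets of
    candidates only shrink, so [x] and [y] remain maximal. *)
Lemma Lcond_U1 M x y x' y' : Lcond E M x y -> x != x' -> y != y' ->
  Lcond E ((x', y') |: M) x y.
Proof.
move=> LC nx ny; have fxy : free_edge ((x', y') |: M) x y.
  by rewrite free_edge_U1 nx ny Lcond_free.
have xL : x \in Lfree E ((x', y') |: M) by apply/LfreeP; exists y.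
case/andP: LC => xtop ytop; apply/andP; split.
  exact: most_preferred_sub (Lfree_U1 _ _ _) xL xtop.
apply: most_preferred_sub ytop; last by rewrite Lnbr_free.
apply/subsetP => z /setIdP[/(subsetP (Rfree_U1 _ _ _)) zR xz].
exact/setIdP.
Qed.

Lemma Rcond_U1 M x y x' y' : Rcond E M x y -> x != x' -> y != y' ->
  Rcond E ((x', y') |: M) x y.
Proof.
move=> RC nx ny; have fxy : free_edge ((x', y') |: M) x y.
  by rewrite free_edge_U1 nx ny Rcond_free.
have yR : y \in Rfree E ((x', y') |: M) by apply/RfreeP; exists x.
case/andP: RC => ytop xtop; apply/andP; split.
  exact: most_preferred_sub (Rfree_U1 _ _ _) yR ytop.
apply: most_preferred_sub xtop; last by rewrite Rnbr_free.
apply/subsetP => z /setIdP[/(subsetP (Lfree_U1 _ _ _)) zL xz].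
exact/setIdP.
Qed.

Lemma Lcond_ex M x y : free_edge M x y -> exists x' y', Lcond E M x' y'.
Proof.
move=> fxy; have /most_preferred_ex[x' x'top] : x \in Lfree E M.
  by apply/LfreeP; exists y.
have x'L := most_preferred_in x'top; have /LfreeP[z] := x'L.
rewrite -Lnbr_free // => /most_preferred_ex[y' y'top].
by exists x', y'; apply/andP.
Qed.

(** * Arcs, diamonds and sinks of the digraph *)

Lemma matchingP M :
  reflect (M \subset E /\ {in M &, forall e f, e.1 = f.1 \/ e.2 = f.2 -> e = f})
          (matching E M).
Proof.
apply: (iffP andP) => -[sME inj]; split=> //.
  move=> e f eM fM ef.
  apply/eqP/(implyP (forall_inP (forall_inP inj e eM) f fM))/orP.
  by case: ef => ->; [left | right].
apply/forall_inP => e eM; apply/forall_inP => f fM; apply/implyP => ef.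
by apply/eqP/inj => //; case/orP: ef => /eqP; [left | right].
Qed.

Lemma free_edge_disjoint M x y e : free_edge M x y -> e \in M ->
  e.1 <> x /\ e.2 <> y.
Proof.
case: e => a b /and3P[/existsPn nx /existsPn ny _] eM; split=> /= eq_e.
  by case/negP: (nx b); rewrite -eq_e.
by case/negP: (ny a); rewrite -eq_e.
Qed.

Lemma matching_U1 M x y :
  matching E M -> free_edge M x y -> matching E ((x, y) |: M).
Proof.
move=> /matchingP[sME inj] fxy; have disj := free_edge_disjoint fxy.
apply/matchingP; split.
  by rewrite subUset sub1set sME andbT; case/and3P: fxy.
move=> e f /setU1P[->|eM] /setU1P[->|fM] //=; last exact: inj.
  by case: (disj f fM) => n1 n2 [/esym|/esym].
by case: (disj e eM) => n1 n2 [].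
Qed.

(** The nonemptiness clauses of [DGarc] follow from either condition, since the chosen edge is free
    and its endpoints lie in [Lfree] and [Rfree]. *)
Lemma DGarcP v w :
  reflect (exists x y, val w = (x, y) |: val v /\
                       (Lcond E (val v) x y \/ Rcond E (val v) x y))
          (DGarc v w).
Proof.
apply: (iffP and3P) => [[_ _ /existsP[x /existsP[y /andP[/eqP wE /orP C]]]]|].
  by exists x, y.
case=> x [y [wE C]]; have fxy : free_edge (val v) x y.
  by case: C => [/Lcond_free|/Rcond_free].
split.
- by apply/set0Pn; exists x; apply/LfreeP; exists y.
- by apply/set0Pn; exists y; apply/RfreeP; exists x.
- apply/existsP; exists x; apply/existsP; exists y.
  by rewrite wE eqxx; apply/orP.
Qed.

Lemma DGarc_card v w : DGarc v w -> #|val v| < #|val w|.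
Proof.
move=> /DGarcP[x [y [-> C]]]; rewrite cardsU1 free_edge_notin //.
by case: C => [/Lcond_free|/Rcond_free].
Qed.

Lemma DGarc_LR_diamond v w1 w2 x y x' y' :
    val w1 = (x, y) |: val v -> Lcond E (val v) x y ->
    val w2 = (x', y') |: val v -> Rcond E (val v) x' y' ->
  w1 = w2 \/ exists2 u, DGarc w1 u & DGarc w2 u.
Proof.
move=> w1E LC w2E RC; case: (Lcond_Rcond LC RC) => [eq_e|[nx ny]].
  by left; apply: val_inj; rewrite w1E eq_e.
right; have RC1 : Rcond E (val w1) x' y' by rewrite w1E Rcond_U1 // eq_sym.
have LC2 : Lcond E (val w2) x y by rewrite w2E Lcond_U1.
(* The common successor is [val v] with both edges added, built here from [w1]; [setUCA] swaps the
   order of insertion to view it from [w2]. *)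
exists (Sub _ (matching_U1 (valP w1) (Rcond_free RC1))); apply/DGarcP.
  by exists x', y'; rewrite SubK; split=> //; right.
by exists x, y; rewrite SubK w1E w2E setUCA -w2E; split=> //; left.
Qed.

Lemma DGarc_diamond v w1 w2 : DGarc v w1 -> DGarc v w2 ->
  w1 = w2 \/ exists2 u, DGarc w1 u & DGarc w2 u.
Proof.
move=> /DGarcP[x [y [w1E C1]]] /DGarcP[x' [y' [w2E C2]]].
case: C1 C2 => [C1|C1] [C2|C2].
- by left; apply: val_inj; rewrite w1E w2E (Lcond_uniq C1 C2).
- exact: DGarc_LR_diamond w1E C1 w2E C2.
- case: (DGarc_LR_diamond w2E C2 w1E C1) => [->|[u]]; first by left.
  by right; exists u.
- by left; apply: val_inj; rewrite w1E w2E (Rcond_uniq C1 C2).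
Qed.

(** An edge of a strictly larger matching is free, and any free edge yields an L-arc out of [v].
    Conversely, an arc leads to a strictly larger matching. *)
Lemma sink_maximal v : sink v = maximal_matching E (val v).
Proof.
apply/forallP/maxsetP => [vsink|[_ vmax] w].
  split=> [|M matM sM]; first exact: valP.
  apply/eqP; rewrite eqEsubset sM andbT; apply/subsetP => -[x y] Mxy.
  apply: contraT => nxy; have /matchingP[sME inj] := matM.
  have [] : exists x' y', Lcond E (val v) x' y'.
    (* An edge of [val v] sharing an endpoint with [(x, y)] would equal it, both lying in the
       matching [M]; but [(x, y)] is not in [val v]. *)
    apply: (@Lcond_ex _ x y); apply/and3P; split; last exact: (subsetP sME).
      apply/existsPn => z; apply: contra nxy => vz.
      by rewrite (inj _ _ Mxy (subsetP sM _ vz)) //; left.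
    apply/existsPn => z; apply: contra nxy => vz.
    by rewrite (inj _ _ Mxy (subsetP sM _ vz)) //; right.
  move=> x' [y' LC].
  case/negP: (vsink (Sub _ (matching_U1 (valP v) (Lcond_free LC)))).
  by apply/DGarcP; exists x', y'; rewrite SubK; split=> //; left.
apply/negP => vw; have := DGarc_card vw; rewrite (vmax (val w)) ?ltnn ?valP //.
by case/DGarcP: vw => x [y [-> _]]; apply: subsetUr.
Qed.

Lemma greedy_matching_unique : exists! v : DGvertex E, greedy_matching v.
Proof.
(* The measure for the confluence argument is the number of edges in the matching. *)
have bound v : #|val v| <= #|{: L * R}| by apply: max_card.
have [s ts es] := connect_terminal bound DGarc_card (DGempty E).
exists s; split=> [|t /andP[tt et]]; first by apply/andP.
exact: (terminal_uniq bound DGarc_card DGarc_diamond ts tt es et).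
Qed.

End Greedy.

Theorem theorem1 (dL dR : Order.disp_t) (L : finOrderType dL)
    (R : finOrderType dR) (E : {set L * R}) :
  (exists! v : DGvertex E, greedy_matching v) /\
  (exists! v : DGvertex E,
     maximal_matching E (val v) /\ reachable (DGempty E) v).
Proof.
(* Both claims have the same witness: [sink_maximal] turns sinks into maximal matchings. *)
have [s [gs s_uniq]] := greedy_matching_unique E; split; exists s; split=> //.
  by rewrite -sink_maximal; apply/andP.
by move=> t [mt et]; apply: s_uniq; rewrite /greedy_matching sink_maximal mt.
Qed.
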